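(* Let $G$ be a finite group, let $U$ and $V$ be subgroups of $G$, let $1_U^G$ and $1_V^G$ be the permutation characters for the action of $G$ on the right cosets of $U$ and $V$ respectively, and let $N$ be a normal subgroup of $G$. If $1_U^G=1_V^G$, then $1_{UN}^G=1_{VN}^G$.
   Context: For a subgroup $W$ of a finite group $G$, $1_W^G$ denotes the permutation character of the action of $G$ by right multiplication on the set of right cosets $\{Wx : x\in G\}$; that is, for $g\in G$, $1_W^G(g)$ is the number of right cosets $Wx$ with $Wxg=Wx$. Since $N$ is normal in $G$, the products $UN=\{un : u\in U, n\in N\}$ and $VN=\{vn : v\in V, n\in N\}$ are subgroups of $G$, and $1_{UN}^G$, $1_{VN}^G$ are the corresponding permutation characters. Equality of characters means equality as functions on $G$. *)

(* Defs.v *)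
From mathcomp Require Import all_boot all_fingroup.

Set Implicit Arguments.
Unset Strict Implicit.
Unset Printing Implicit Defensive.

Local Open Scope group_scope.

(* Number of right cosets W :* x, x \in G, fixed by right multiplication by g;
   meaningful for g \in G.  W is a plain set, so that the setwise product
   U * N can be used as it stands. *)
Definition perm_char (gT : finGroupType) (G W : {set gT}) (g : gT) : nat :=
  #|'Fix_(rcosets W G | 'Rs)[g]|.

(* Main.v *)
Require Import Defs.
From mathcomp Require Import all_boot all_fingroup.

(* Counting elements instead of cosets gives
   |W| 1_W^G(g) = #{x in G | g in W^x}.  For fixed x, the number of n in N with
   g n in U^x is |U :&: N| if g in (U N)^x, and 0 otherwise.  Summing over x
   and using |U| |N| = |U N| |U :&: N| gives
   |N| 1_{UN}^G(g) = \sum_(n in N) 1_U^G(g n),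
   so that 1_{UN}^G is determined by 1_U^G. *)

Set Implicit Arguments.
Unset Strict Implicit.
Unset Printing Implicit Defensive.

Local Open Scope group_scope.

Lemma rcoset_fix (gT : finGroupType) (W : {group gT}) (x g : gT) :
  (W :* x :* g == W :* x) = (g \in W :^ x).
Proof.
rewrite -rcosetM (sameP eqP rcoset_eqP).
by rewrite mem_rcoset mem_conjg conjgE invgK mulgA.
Qed.

(** Whether [g \in W :^ x] depends only on the coset [W :* x], so each fixed coset accounts for
    exactly [#|W|] elements [x]. *)
Lemma perm_char_card (gT : finGroupType) (G W : {group gT}) (g : gT) :
  W \subset G ->
  (perm_char G W g * #|W|)%N = #|[set x in G | g \in W :^ x]|.
Proof.
move=> sWG; rewrite /perm_char -sum_nat_const.
set F := 'Fix_(_ | _)[g].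
have fixE x : x \in G -> (W :* x \in F) = (g \in W :^ x).
  move=> Gx; rewrite !inE -rcosetE imset_f //= sub1set inE /= !rcosetE.
  exact: rcoset_fix.
rewrite -[RHS]sum1_card (partition_big (rcoset W) (mem F)) /=; last first.
  by move=> x; rewrite inE => /andP[Gx]; rewrite rcosetE fixE.
apply: eq_bigr => A FA.
have /rcosetsP[y Gy defA] : A \in rcosets W G by case/setIP: FA.
rewrite -(card_rcoset W y) -sum1_card; apply: eq_bigl => x.
rewrite inE rcosetE defA (sameP eqP rcoset_eqP).
have [Wyx | //] := boolP (x \in _); rewrite ?andbF ?andbT //.
have Gx : x \in G.
  by case/rcosetP: Wyx => w Ww ->; rewrite groupM // (subsetP sWG).
by rewrite Gx -fixE // (rcoset_eqP Wyx) -defA FA.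
Qed.

(** If [g = k * m], the solutions [n] form the left coset of [K :&: N] by [m^-1]; conversely, any
    solution gives [g = (g * n) * n^-1]. *)
Lemma card_translate_setI (gT : finGroupType) (K N : {group gT}) (g : gT) :
  #|[set n in N | g * n \in K]| = ((g \in (K * N)%g) * #|K :&: N|)%N.
Proof.
have [/mulsgP[k m Kk Nm ->] | notKN] := boolP (g \in K * N).
  rewrite mul1n -(card_lcoset (K :&: N) m^-1); apply: eq_card => n.
  by rewrite mem_lcoset invgK !inE -mulgA (groupMl _ Kk) (groupMl _ Nm) andbC.
rewrite mul0n; apply: eq_card0 => n; rewrite inE.
apply: contraNF notKN => /andP[Nn Kgn].
by rewrite -(mulgK n g) mem_mulg ?groupV.
Qed.

Lemma sum_perm_char (gT : finGroupType) (G U N : {group gT}) (g : gT) :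
  U \subset G -> N <| G ->
  (\sum_(n in N) perm_char G U (g * n)%g)%N =
    (#|N| * perm_char G (U * N)%g g)%N.
Proof.
move=> sUG /andP[sNG nNG].
(* [perm_char_card] needs a group, and [U * N] is only a set. *)
have defUN : U <*> N = U * N by apply: norm_joinEl; apply: subset_trans nNG.
have sUNG : U <*> N \subset G by rewrite join_subG sUG.
apply/eqP; rewrite -(eqn_pmul2r (cardG_gt0 U)); apply/eqP.
rewrite mulnAC [(#|N| * #|U|)%N]mulnC mul_cardG -defUN -mulnA.
rewrite [RHS]mulnC -mulnA (perm_char_card g sUNG).
rewrite big_distrl /=.
transitivity (\sum_(n in N) \sum_(x in G) ((g * n)%g \in U :^ x))%N.
  apply: eq_bigr => n _; rewrite (perm_char_card _ sUG) -sum1dep_card.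
  by rewrite big_mkcondr; apply: eq_bigr => x _; case: ifP.
rewrite exchange_big /= mulnC -sum1dep_card big_mkcondr /= big_distrl /=.
apply: eq_bigr => x Gx.
have nNx : N :^ x = N by apply: normP; apply: (subsetP nNG).
have := card_translate_setI (U :^ x)%G N g.
(* Writing [N] as [N :^ x] in the product and the intersection turns them into conjugates of [U * N]
   and [U :&: N]; the index set stays [N]. *)
rewrite -{2 3}nNx -conjIg cardJg -conjsMg -defUN => <-.
rewrite -sum1dep_card big_mkcondr; apply: eq_bigr => n _.
by case: ifP.
Qed.

Theorem theorem1 (gT : finGroupType) (G U V N : {group gT})
    (sUG : U \subset G) (sVG : V \subset G) (nNG : N <| G)
    (eqUV : {in G, perm_char G U =1 perm_char G V}) :
  {in G, perm_char G (U * N) =1 perm_char G (V * N)}.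
Proof.
move=> g Gg; apply/eqP; rewrite -(eqn_pmul2l (cardG_gt0 N)); apply/eqP.
(* The hypothesis applies termwise, since [g * n] stays in [G]. *)
rewrite -!sum_perm_char //; apply: eq_bigr => n Nn.
by rewrite eqUV // groupM // (subsetP (normal_sub nNG)).
Qed.
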